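(* There is a universal constant $C$ such that for every Boolean function $f:\{0,1\}^n\to\{0,1\}$, $\mathrm{D}(f)\le C\,\mathrm{Q}(f)^4$.
   Context: $\mathrm{D}(f)$ is the deterministic query complexity of $f$: the minimum, over deterministic algorithms that compute $f(x)$ by querying bits of $x$, of the worst-case number of queries. $\mathrm{Q}(f)$ is the bounded-error quantum query complexity: the minimum number of queries of a quantum query algorithm that outputs $f(x)$ with probability at least $2/3$ on every input $x$. *)

(* Defs.v *)
(* complex numbers = mathcomp-real-closed's complex over the
   Stdlib reals (a realType, hence rcfType, via Rstruct). *)
From mathcomp Require Import all_boot all_algebra.
From mathcomp Require Import complex Rstruct.
Set Implicit Arguments. Unset Strict Implicit. Unset Printing Implicit Defensive.
Import GRing.Theory Num.Theory.
Local Open Scope ring_scope.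

(* The field of complex numbers. *)
Definition Cplx : numClosedFieldType := (Rdefinitions.R)[i].

(* Inputs x in {0,1}^n are finite functions 'I_n -> bool; a Boolean
   function f : {0,1}^n -> {0,1} is a map from inputs to bool. *)
Definition input (n : nat) := {ffun 'I_n -> bool}.

(* ---------- Deterministic query algorithms = decision trees ---------- *)
Inductive dtree (n : nat) : Type :=
| DLeaf of bool
| DNode of 'I_n & dtree n & dtree n. (* query x_i; left if 0, right if 1 *)

Fixpoint deval n (t : dtree n) (x : input n) : bool :=
  match t with
  | DLeaf b => b
  | DNode i t0 t1 => if x i then deval t1 x else deval t0 x
  end.

(* worst-case number of queries *)
Fixpoint depth n (t : dtree n) : nat :=
  match t with
  | DLeaf _ => 0
  | DNode _ t0 t1 => (maxn (depth t0) (depth t1)).+1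
  end.

(* t computes f with at most q queries on every input *)
Definition dcomputes n (f : input n -> bool) (q : nat) : Prop :=
  exists t : dtree n, (forall x, deval t x = f x) /\ (depth t <= q)%N.

(* ---------- Quantum query algorithms ---------- *)
(* State space C^{(n+1) m}: basis states |k> with k : 'I_((n+1)*m),
   read as pairs |i, w> with query register i = k %/ m in {0,..,n}
   and workspace w = k %% m in {0,..,m-1}.  States are row vectors. *)
Definition qdim (n m : nat) := (n.+1 * m)%N.

(* The queried variable of basis state k: none if i = 0, x_{i-1} otherwise. *)
Definition qidx n m (k : 'I_(qdim n m)) : option 'I_n :=
  match (k %/ m)%N with
  | 0%N => None
  | j.+1 => insub j
  end.

(* Phase oracle: O_x |0,w> = |0,w>,  O_x |i,w> = (-1)^{x_{i-1}} |i,w>. *)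
Definition oracle n m (x : input n) : 'M[Cplx]_(qdim n m) :=
  diag_mx (\row_k match qidx k with
                  | None => 1
                  | Some i => (-1) ^+ x i
                  end).

Definition unitary d (U : 'M[Cplx]_d) : Prop :=
  U *m (map_mx (fun z : Cplx => z^*) U)^T = 1%:M.

(* initial state |0> = |0,0> *)
Definition init_state d : 'rV[Cplx]_d := \row_k (((k : nat) == 0%N)%:R).

(* state after applying U_0, O_x, U_1, ..., O_x, U_t  (t queries) *)
Fixpoint qrun n m (U : nat -> 'M[Cplx]_(qdim n m)) (x : input n) (t : nat)
  : 'rV[Cplx]_(qdim n m) :=
  match t with
  | 0%N => init_state _ *m U 0%N
  | t'.+1 => qrun U x t' *m oracle m x *m U t
  end.

(* Probability that measuring the final state in the computational basis
   yields a basis state k with out k = b. *)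
Definition out_prob n m (U : nat -> 'M[Cplx]_(qdim n m)) (out : pred 'I_(qdim n m))
  (T : nat) (x : input n) (b : bool) : Cplx :=
  \sum_(k | out k == b) `|qrun U x T 0 k| ^+ 2.

(* f is computed with bounded error (>= 2/3 on every input) by a quantum
   query algorithm U_T O_x ... O_x U_0 making exactly T queries, with any
   workspace size m >= 1, unitaries U_0..U_T and output measurement out. *)
Definition qcomputes n (f : input n -> bool) (T : nat) : Prop :=
  exists (m : nat) (U : nat -> 'M[Cplx]_(qdim n m)) (out : pred 'I_(qdim n m)),
    (0 < m)%N /\
    (forall t, (t <= T)%N -> unitary (U t)) /\
    (forall x : input n, 2%:R / 3%:R <= out_prob U out T x (f x)).

(* Main.v *)
Require Import Defs.
From mathcomp Require Import all_boot all_order all_algebra.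
From mathcomp Require Import complex Rstruct zify ring.

(* Two lower bounds on the number [T] of quantum queries are combined.  Both
   follow from the adversary method with nonnegative weights [v] on the inputs,
   for a graph whose edges flip one of a family of pairwise disjoint blocks.
   - A star centred at [x] bounds the number of disjoint sensitive blocks at [x]
     by [O(T^2)].
   - If [f] restricted to a subcube of dimension [d] has full degree [d], then,
     after multiplying by the parity, one of the two signs occupies more than
     half of the subcube.  Huang's signed adjacency matrix [A] satisfies
     [A^2 = d], so it has an eigenvector for [sqrt d] supported on that sign
     class, in which all edges are sensitive; its absolute values serve as [v]
     and give [d = O(T^2)].
   Midrijanis' decision tree repeatedly queries all variables of a maximal
   monomial of what remains of [f].  Each costs [O(T^2)] queries, and each
   contains a block that is sensitive at the actual input whatever the other
   variables are, so there are [O(T^2)] rounds. *)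

Set Implicit Arguments. Unset Strict Implicit. Unset Printing Implicit Defensive.
Import Order.TTheory GRing.Theory Num.Theory.
Local Open Scope ring_scope.

(** * Flipping a block of bits *)

Definition flip n (x : input n) (B : {set 'I_n}) : input n :=
  [ffun i => x i (+) (i \in B)].

Lemma flipK n (B : {set 'I_n}) : involutive (fun x : input n => flip x B).
Proof. by move=> x; apply/ffunP=> i; rewrite !ffunE addbK. Qed.

Lemma flipAC n (x : input n) B B' : flip (flip x B) B' = flip (flip x B') B.
Proof. by apply/ffunP=> i; rewrite !ffunE addbAC. Qed.

Lemma flip0 n (x : input n) : flip x set0 = x.
Proof. by apply/ffunP=> i; rewrite ffunE inE addbF. Qed.

Lemma sum_flip n (V : nmodType) (B : {set 'I_n}) (F : input n -> V) :
  \sum_x F (flip x B) = \sum_x F x.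
Proof. by rewrite [RHS](reindex_inj (inv_inj (@flipK n B))). Qed.

(** * The adversary bound *)

Lemma real_AGM (R : numDomainType) (a b : R) :
  a \is Num.real -> b \is Num.real -> 2 * (a * b) <= a ^+ 2 + b ^+ 2.
Proof.
move=> ar br; rewrite -subr_ge0 (_ : _ - _ = (a - b) ^+ 2); last by ring.
by rewrite real_exprn_even_ge0 ?realB.
Qed.

Section Dot.
Variable d : nat.
Implicit Types a b : 'rV[Cplx]_d.

Definition dot a b : Cplx := \sum_k a 0 k * (b 0 k)^*.

Lemma dotE a b : dot a b = (a *m (map_mx (fun z : Cplx => z^*) b)^T) 0 0.
Proof. by rewrite mxE; apply: eq_bigr => k _; rewrite !mxE. Qed.

Lemma dotxx a : dot a a = \sum_k `|a 0 k| ^+ 2.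
Proof. by apply: eq_bigr => k _; rewrite normCK. Qed.

Lemma dot_unitary (U : 'M[Cplx]_d) a b :
  unitary U -> dot (a *m U) (b *m U) = dot a b.
Proof.
move=> hU; rewrite !dotE (map_mxM (Num.conj : {rmorphism Cplx -> Cplx})) trmx_mul.
by rewrite mulmxA -[a *m U *m _]mulmxA hU mulmx1.
Qed.

Lemma norm_dot_le a b : `|dot a b| <= \sum_k `|a 0 k| * `|b 0 k|.
Proof.
apply: le_trans (ler_norm_sum _ _ _) _.
by apply: ler_sum => k _; rewrite normrM norm_conjC.
Qed.

(** Weighted AM-GM with weight 4 on the state whose mass dominates on that side and 9 on the other.
    The value 17/18 is rational and slightly above the optimal [2 * sqrt 2 / 3]. *)
Lemma norm_dot_distinguished (P : pred 'I_d) a b :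
  dot a a = 1 -> dot b b = 1 ->
  2 / 3 <= \sum_(k | P k) `|a 0 k| ^+ 2 ->
  2 / 3 <= \sum_(k | ~~ P k) `|b 0 k| ^+ 2 ->
  `|dot a b| <= 17 / 18.
Proof.
rewrite !dotxx => a1 b1 ha hb.
(* Cauchy-Schwarz would correspond to the ratio 1 : 2 instead of 4 : 9. *)
have agm (s t : Cplx) : 12 * (`|s| * `|t|) <= 4 * `|s| ^+ 2 + 9 * `|t| ^+ 2.
  have := @real_AGM Cplx (2 * `|s|) (3 * `|t|).
  rewrite !realM ?normr_real ?realn // => /(_ isT isT).
  by congr (_ <= _); ring.
have h : 12 * `|dot a b| <= 34 / 3.
  apply: le_trans (_ : 13 - 5 * \sum_(k | P k) `|a 0 k| ^+ 2
                       - 5 * (\sum_(k | ~~ P k) `|b 0 k| ^+ 2 - 1) <= _).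
    apply: le_trans (ler_wpM2l _ (norm_dot_le a b)) _; first exact: ler0n.
    have -> : 13 - 5 * \sum_(k | P k) `|a 0 k| ^+ 2
              - 5 * (\sum_(k | ~~ P k) `|b 0 k| ^+ 2 - 1) =
       \sum_(k | P k) (4 * `|a 0 k| ^+ 2 + 9 * `|b 0 k| ^+ 2) +
       \sum_(k | ~~ P k) (4 * `|b 0 k| ^+ 2 + 9 * `|a 0 k| ^+ 2).
      rewrite !big_split -!mulr_sumr /=.
      have -> : \sum_(k | ~~ P k) `|a 0 k| ^+ 2 = 1 - \sum_(k | P k) `|a 0 k| ^+ 2.
        by rewrite -a1 [in X in _ = X - _](bigID P) /= addrAC subrr add0r.
      have -> : \sum_(k | P k) `|b 0 k| ^+ 2 = 1 - \sum_(k | ~~ P k) `|b 0 k| ^+ 2.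
        by rewrite -b1 [in X in _ = X - _](bigID P) /= addrK.
      by ring.
    rewrite mulr_sumr (bigID P) /=; apply: lerD; apply: ler_sum => k _ //.
    by rewrite [`|a 0 k| * _]mulrC.
  have -> : 34 / 3 = 13 - 5 * (2 / 3) - 5 * (2 / 3 - 1) :> Cplx by field.
  by rewrite lerB ?lerB ?ler_wpM2l ?ler0n ?lerD2r.
rewrite -(ler_pM2l (_ : 0 < 12)) ?ltr0n //.
by rewrite (_ : 12 * (17 / 18) = 34 / 3) //; field.
Qed.

End Dot.

Definition queries_in n m (B : {set 'I_n}) (k : 'I_(qdim n m)) : bool :=
  if qidx k is Some i then i \in B else false.

(** The two phase oracles agree on basis states querying outside [B] and are opposite on the others,
    whose contribution to the inner product thus changes sign. *)
Lemma dot_oracle n m (x : input n) B (a b : 'rV[Cplx]_(qdim n m)) :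
  dot a b - dot (a *m oracle m x) (b *m oracle m (flip x B)) =
  \sum_(k | queries_in B k) 2 * (a 0 k * (b 0 k)^*).
Proof.
rewrite /dot -sumrB [RHS]big_mkcond; apply: eq_bigr => k _.
rewrite /oracle !mul_mx_diag !mxE /queries_in.
case: (qidx k) => [i|]; last by rewrite !mulr1 subrr.
rewrite ffunE signr_addb !rmorphM !rmorphXn rmorphN1 /=.
have := signrMK (x i) (1 : Cplx); rewrite mulr1.
move: ((-1) ^+ x i : Cplx) => s ss.
rewrite (_ : _ * s * _ = a 0 k * (b 0 k)^* * (-1) ^+ (i \in B) * (s * s)); last by ring.
rewrite ss mulr1; case: (i \in B); by rewrite ?expr1 ?expr0; ring.
Qed.

Lemma norm_dot_oracle n m (x : input n) B (a b : 'rV[Cplx]_(qdim n m)) :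
  `|dot a b - dot (a *m oracle m x) (b *m oracle m (flip x B))| <=
  \sum_(k | queries_in B k) 2 * (`|a 0 k| * `|b 0 k|).
Proof.
rewrite dot_oracle; apply: le_trans (ler_norm_sum _ _ _) _.
by apply: ler_sum => k _; rewrite !normrM norm_conjC normr_nat.
Qed.

Lemma oracle_isometry n m (x : input n) (a : 'rV[Cplx]_(qdim n m)) :
  dot (a *m oracle m x) (a *m oracle m x) = dot a a.
Proof.
have := dot_oracle x set0 a a; rewrite flip0 big1 => [|k].
  by move/eqP; rewrite subr_eq0 => /eqP.
by rewrite /queries_in; case: (qidx k) => // i; rewrite inE.
Qed.

Section Adversary.
Variables (n : nat) (J : finType) (D : {set J}) (B : J -> {set 'I_n}).
Hypothesis disjB : forall i j j',
  j \in D -> j' \in D -> i \in B j -> i \in B j' -> j = j'.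
Variable f : input n -> bool.
Variable v : input n -> Cplx.
Hypothesis v_ge0 : forall x, 0 <= v x.

Local Notation sens x j := ((j \in D) && (f (flip x (B j)) != f x)).

(** Ambainis' progress measure: all overlaps start at 1, and a correct algorithm must shrink those
    of sensitive pairs by a constant factor. *)
Definition progress m (psi : input n -> 'rV[Cplx]_(qdim n m)) : Cplx :=
  \sum_x \sum_(j | sens x j)
    v x * v (flip x (B j)) * dot (psi x) (psi (flip x (B j))).

(** AM-GM charges each pair to its two endpoints. A basis state queries at most one of the disjoint
    blocks, so the total does not grow with their number. *)
Lemma progress_oracle m (psi : input n -> 'rV[Cplx]_(qdim n m)) :
  (forall x, dot (psi x) (psi x) = 1) ->
  `|progress psi - progress (fun x => psi x *m oracle m x)| <=
  2 * \sum_x v x ^+ 2.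
Proof.
move=> psi1.
pose a x k := v x * `|psi x 0 k|.
have ar x k : a x k \is Num.real by rewrite realM ?ger0_real.
rewrite /progress -sumrB; apply: le_trans (ler_norm_sum _ _ _) _.
(* Insensitive pairs are added as nonnegative terms, so that the index set no longer depends on
   [x]. *)
apply: le_trans (_ : \sum_x \sum_(j in D) \sum_(k | queries_in (B j) k)
                       (a x k ^+ 2 + a (flip x (B j)) k ^+ 2) <= _).
  apply: ler_sum => x _; rewrite -sumrB; apply: le_trans (ler_norm_sum _ _ _) _.
  rewrite big_mkcondr /=; apply: ler_sum => j _; case: ifP => _; last first.
    by apply: sumr_ge0 => k _; rewrite addr_ge0 // real_exprn_even_ge0.
  rewrite -mulrBr normrM ger0_norm ?mulr_ge0 //.
  apply: le_trans (ler_wpM2l _ (norm_dot_oracle _ _ _ _)) _; first exact: mulr_ge0.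
  rewrite mulr_sumr; apply: ler_sum => k _.
  by apply: le_trans (real_AGM (ar _ _) (ar _ _)); rewrite mulrCA mulrACA.
rewrite exchange_big /=.
(* Flipping [B j] permutes the inputs, so both endpoints contribute the same total. *)
have -> : \sum_(j in D) \sum_x \sum_(k | queries_in (B j) k)
             (a x k ^+ 2 + a (flip x (B j)) k ^+ 2) =
          \sum_(j in D) \sum_x \sum_(k | queries_in (B j) k) 2 * a x k ^+ 2.
  apply: eq_bigr => j _; under eq_bigr do rewrite big_split.
  rewrite big_split /= (sum_flip (B j) (fun x => \sum_(k | queries_in (B j) k) a x k ^+ 2)).
  rewrite -big_split; apply: eq_bigr => x _; rewrite -big_split.
  by apply: eq_bigr => k _; rewrite mulr_natl mulr2n.
rewrite exchange_big /= mulr_sumr; apply: ler_sum => x _.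
rewrite (exchange_big_dep xpredT) //=.
apply: le_trans (_ : \sum_k 2 * a x k ^+ 2 <= _).
  apply: ler_sum => k _; rewrite sumr_const -[leRHS]mulr1n ler_wpMn2l //; last first.
    apply/card_le1_eqP => j j' /andP[jD kj] /andP[j'D].
    move: kj; rewrite /queries_in; case: (qidx k) => // i hj hj'.
    exact: disjB j'D jD hj' hj.
  by rewrite mulr_ge0 ?ler0n ?real_exprn_even_ge0.
rewrite -mulr_sumr; under eq_bigr do rewrite exprMn.
by rewrite -mulr_sumr -dotxx psi1 mulr1.
Qed.

(** A Rayleigh quotient bound for the sensitivity graph with test vector [v]. Progress falls from
    [L] to at most [17 / 18 * L], by at most twice the squared norm of [v] per query; hence 36 = 18
    * 2. *)
Lemma adversary T : qcomputes f T ->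
  \sum_x \sum_(j | sens x j) v x * v (flip x (B j)) <= (36 * T)%:R * \sum_x v x ^+ 2.
Proof.
case=> m [U [out [m0 [Uu hout]]]].
pose psi t x := qrun U x t.
set L := \sum_x _.
have psi1 t x : (t <= T)%N -> dot (psi t x) (psi t x) = 1.
  elim: t => [|t IH] tT.
    rewrite /psi /= dot_unitary; last exact: Uu.
    have k0 : (0 < qdim n m)%N by rewrite muln_gt0.
    rewrite dotxx (bigD1 (Ordinal k0)) //= big1 => [|k]; last first.
      by rewrite mxE -val_eqE /= => /negbTE->; rewrite normr0 expr0n.
    by rewrite mxE normr1 expr1n addr0.
  rewrite /psi /= dot_unitary; last exact: Uu.
  by rewrite oracle_isometry IH // ltnW.
have W0 : progress (psi 0%N) = L.
  apply: eq_bigr => x _; apply: eq_bigr => j _.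
  have /(_ x) := @psi1 0%N _ isT; rewrite /psi /= => ->.
  by rewrite mulr1.
have Wt t : (t <= T)%N -> L <= `|progress (psi t)| + (2 * t)%:R * \sum_x v x ^+ 2.
  elim: t => [|t IH] tT.
    by rewrite W0 muln0 mul0r addr0 real_ler_norm //; apply: ger0_real;
       apply: sumr_ge0 => x _; apply: sumr_ge0 => j _; rewrite mulr_ge0.
  apply: le_trans (IH (ltnW tT)) _.
  have -> : progress (psi t.+1) = progress (fun x => psi t x *m oracle m x).
    apply: eq_bigr => x _; apply: eq_bigr => j _.
    by rewrite /psi /= dot_unitary //; apply: Uu.
  have h := progress_oracle (fun x => psi1 t x (ltnW tT)).
  rewrite mulnS natrD mulrDl addrA lerD2r.
  by rewrite -lerBlDl; apply: le_trans h; apply: lerB_dist.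
have WT : `|progress (psi T)| <= 17 / 18 * L.
  apply: le_trans (ler_norm_sum _ _ _) _; rewrite mulr_sumr; apply: ler_sum => x _.
  apply: le_trans (ler_norm_sum _ _ _) _; rewrite mulr_sumr; apply: ler_sum => j /andP[_ fj].
  rewrite normrM ger0_norm ?mulr_ge0 // mulrC ler_wpM2r ?mulr_ge0 //.
  (* On a sensitive pair the correct outputs differ, so the second state has mass at least 2/3 where
     [out] differs from [f x]. *)
  apply: (@norm_dot_distinguished _ (fun k => out k == f x)); rewrite ?psi1 //; first exact: hout.
  have := hout (flip x (B j)); rewrite /out_prob.
  congr (_ <= _); apply: eq_bigl => k; move: fj.
  by case: (f _) (f _) (out k) => [] [] [].
have := Wt T (leqnn T).
move=> /le_trans /(_ (lerD WT (lexx _))).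
rewrite -lerBlDl.
rewrite -(ler_pM2l (_ : 0 < 18)) ?ltr0n //.
congr (_ <= _); first by field.
by rewrite mulrA -natrM mulnA.
Qed.

End Adversary.

(** * Block sensitivity *)

Lemma sqrtC_le_nat (d c : nat) : sqrtC (d%:R : Cplx) <= c%:R -> (d <= c ^ 2)%N.
Proof.
move=> h; rewrite -(ler_nat Cplx) natrX -[d%:R]sqrtCK.
by rewrite lerXn2r ?nnegrE ?sqrtC_ge0 ?ler0n.
Qed.

(** The test vector is the top eigenvector of the star. With [k] blocks, the terms of the centre
    alone give [k * sqrtC k], against a squared norm of at most [k + k]; hence 72 = 2 * 36. *)
Lemma block_sensitivity n (f : input n -> bool) T (x : input n)
    (F : {set {set 'I_n}}) :
  qcomputes f T -> trivIset F -> (forall B, B \in F -> f (flip x B) != f x) ->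
  (#|F| <= (72 * T) ^ 2)%N.
Proof.
move=> qf tF sF.
have [->|/card_gt0P F0] := posnP #|F|; first exact: leq0n.
have F_gt0 : 0 < (#|F|%:R : Cplx) by rewrite ltr0n; apply/card_gt0P.
set k : Cplx := #|F|%:R in F_gt0.
pose nb := [set flip x B | B in F].
have xnb : x \notin nb.
  by apply/imsetP => -[B /sF fB xE]; move: fB; rewrite -xE eqxx.
pose v y : Cplx := if y == x then sqrtC k else (y \in nb)%:R.
have v_ge0 y : 0 <= v y.
  by rewrite /v; case: ifP => _; rewrite ?sqrtC_ge0 ?ler0n.
have disjF i (B B' : {set 'I_n}) : B \in F -> B' \in F -> i \in B -> i \in B' -> B = B'.
  move=> BF B'F iB iB'; apply/eqP/negPn/negP => neqB.
  have /trivIsetP/(_ B B' BF B'F neqB)/pred0P/(_ i) := tF.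
  by rewrite /= iB iB'.
have := adversary (B := id) disjF v_ge0 qf.
have hv : \sum_y v y ^+ 2 <= k + k.
  rewrite (bigD1 x) //= {1}/v eqxx sqrtCK lerD2l.
  apply: le_trans (_ : \sum_(y in nb) 1 <= _); last first.
    by rewrite sumr_const ler_nat leq_imset_card.
  rewrite [leRHS]big_mkcond [leRHS](bigD1 x) //= (negbTE xnb) add0r.
  apply: ler_sum => y /negbTE yx.
  by rewrite /v yx; case: (y \in nb); rewrite ?expr1n ?expr0n.
move=> /le_trans /(_ (ler_wpM2l (ler0n _ _) hv)).
rewrite (bigD1 x) //= => /(le_trans _) h.
have {}h : k * sqrtC k <= (36 * T)%:R * (k + k).
  apply: h; rewrite -[leLHS]addr0; apply: lerD; last first.
    by apply: sumr_ge0 => y _; apply: sumr_ge0 => B _; rewrite mulr_ge0.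
  rewrite le_eqVlt; apply/orP; left; apply/eqP.
  rewrite mulr_natl -sumr_const; apply: eq_big => [B|B BF].
    by apply/idP/andP => [BF|[]] //; split=> //; apply: sF.
  have hB : flip x B \in nb by apply: imset_f.
  rewrite /v eqxx hB ifF ?mulr1 //; apply: contraNF xnb => /eqP xE.
  by rewrite -{1}xE.
apply: sqrtC_le_nat; rewrite -(ler_pM2l F_gt0); apply: le_trans h _.
by rewrite -mulr2n mulrnAr -mulrnAl -mulrnA mulrC (_ : (36 * T * 2)%N = (72 * T)%N) //; lia.
Qed.

(** * Subcubes *)

Section Cube.
Variable n : nat.
Implicit Types (x y z : input n) (M V : {set 'I_n}).

Definition cube M x : {set input n} :=
  [set y : input n | [forall i, (i \notin M) ==> (y i == x i)]].

Lemma cubeP M x y : reflect (forall i, i \notin M -> y i = x i) (y \in cube M x).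
Proof.
rewrite inE; apply: (iffP forallP) => h i; first by move=> iM; apply/eqP/(implyP (h i)).
by apply/implyP => iM; apply/eqP/h.
Qed.

Lemma cube_refl M x : x \in cube M x.
Proof. exact/cubeP. Qed.

Lemma cube_trans M y x z : y \in cube M x -> z \in cube M y -> z \in cube M x.
Proof. by move=> /cubeP h /cubeP h'; apply/cubeP => i iM; rewrite h' ?h. Qed.

Lemma cube_sym M x y : (y \in cube M x) = (x \in cube M y).
Proof. by apply/cubeP/cubeP => h i iM; rewrite h. Qed.

Lemma cubeS M V x : M \subset V -> cube M x \subset cube V x.
Proof.
move=> /subsetP MV; apply/subsetP => y /cubeP h; apply/cubeP => i iV.
by apply: h; apply: contra iV; apply: MV.
Qed.

Lemma flip_cube M (B : {set 'I_n}) x : B \subset M -> flip x B \in cube M x.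
Proof.
move=> /subsetP BM; apply/cubeP => i iM; rewrite ffunE.
by rewrite (negbTE (contra (BM i) iM)) addbF.
Qed.

Lemma cube_flipP M x y :
  reflect (exists2 B : {set 'I_n}, B \subset M & y = flip x B) (y \in cube M x).
Proof.
apply: (iffP idP) => [/cubeP h|[B BM ->]]; last exact: flip_cube.
exists [set i | x i != y i].
  by apply/subsetP => i; rewrite inE; apply: contraNT => /h ->.
by apply/ffunP => i; rewrite ffunE inE; case: (x i) (y i) => [] [].
Qed.

Lemma cube_eq M x y : y \in cube M x -> cube M y = cube M x.
Proof.
move=> h; apply/setP => z; apply/idP/idP; first exact: cube_trans.
by apply: cube_trans; rewrite cube_sym.
Qed.

Lemma flip_in_cube M x y i : i \in M -> (flip y [set i] \in cube M x) = (y \in cube M x).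
Proof.
move=> iM; have h z : flip z [set i] \in cube M z by apply: flip_cube; rewrite sub1set.
by apply/idP/idP; move=> /cube_trans; apply => //; rewrite cube_sym.
Qed.

Lemma card_cube_flip M (B : {set 'I_n}) x : #|cube M (flip x B)| = #|cube M x|.
Proof.
have le z : (#|cube M z| <= #|cube M (flip z B)|)%N.
  rewrite -(card_imset _ (inv_inj (@flipK n B))); apply: subset_leq_card.
  apply/subsetP => _ /imsetP[y /cubeP yM ->]; apply/cubeP => i iM.
  by rewrite !ffunE yM.
by apply/eqP; rewrite eqn_leq le -{2}[x](flipK B) le.
Qed.

Lemma cube_ind V y (P : input n -> Prop) :
  P y -> (forall z i, z \in cube V y -> i \in V -> P z -> P (flip z [set i])) ->
  forall x, x \in cube V y -> P x.
Proof.
move=> Py step x /cube_flipP[B BV ->{x}].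
have [m] := ubnP #|B|; elim: m B BV => // m IH B BV ltm.
have [->|[i iB]] := set_0Vmem B; first by rewrite flip0.
have sB : B :\ i \subset V by apply: subset_trans (subD1set _ _) BV.
have -> : flip y B = flip (flip y (B :\ i)) [set i].
  by apply/ffunP => j; rewrite !ffunE !inE; case: eqP => [->|]; rewrite ?iB ?addbF.
apply: step; [exact: flip_cube|exact: (subsetP BV)|apply: IH => //].
by move: ltm; rewrite (cardsD1 i) iB.
Qed.

Lemma card_cubeU1 (G : {set input n}) M i x : i \notin M ->
  #|cube (i |: M) x :&: G| = (#|cube M x :&: G| + #|cube M (flip x [set i]) :&: G|)%N.
Proof.
move=> iM.
have h z y : (y \in cube M z) = (y \in cube (i |: M) z) && (y i == z i).
  apply/idP/andP => [yM|[/cubeP yM /eqP yi]].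
    by split; [apply: subsetP yM; apply/cubeS/subsetU1|apply/eqP/(cubeP _ _ _ yM)].
  apply/cubeP => j jM; have [->//|ji] := eqVneq j i.
  by apply: yM; rewrite !inE negb_or ji.
pose S := [set y : input n | y i == x i].
have hS y : (y \in S) = (y i == x i) by rewrite inE.
have -> : cube M x = cube (i |: M) x :&: S.
  by apply/setP => y; rewrite in_setI hS h.
have -> : cube M (flip x [set i]) = cube (i |: M) x :\: S.
  apply/setP => y; rewrite in_setD hS h (cube_eq (flip_cube _ _)) ?sub1set ?setU11 //.
  by rewrite andbC ffunE set11; case: (y i) (x i) => [] [].
by rewrite -(cardsID S) setIAC setIDAC.
Qed.

Lemma cube0 x : cube set0 x = [set x].
Proof.
apply/setP => y; rewrite [RHS]inE; apply/cubeP/eqP => [h|-> //].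
by apply/ffunP => i; apply: h; rewrite inE.
Qed.

End Cube.

(** * Huang's signed adjacency operator *)

(** Dimension count: unknowns are indexed by [A] and the fewer equations by [B], so the coefficient
    matrix has a nonzero left kernel. *)
Lemma exists_vanishing (F : fieldType) (I : finType) (A B : {set I}) (K : I -> I -> F) :
  (#|B| < #|A|)%N ->
  exists w : I -> F, [/\ exists x, w x != 0, forall x, x \notin A -> w x = 0
    & forall y, y \in B -> \sum_x w x * K x y = 0].
Proof.
move=> ltBA.
pose N := \matrix_(a < #|A|, b < #|B|) K (enum_val a) (enum_val b).
have : kermx N != 0.
  rewrite -mxrank_eq0 mxrank_ker subn_eq0 -ltnNge.
  exact: leq_ltn_trans (rank_leq_col N) ltBA.
case/rowV0Pn => v /sub_kermxP vN /rV0Pn[a va].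
exists (fun x => \sum_b v 0 b * (x == enum_val b)%:R); split.
- exists (enum_val a); rewrite (bigD1 a) //= eqxx mulr1 big1 ?addr0 // => b ba.
  by rewrite (inj_eq enum_val_inj) eq_sym (negbTE ba) mulr0.
- move=> x xA; apply: big1 => b _.
  by rewrite (negbTE (contraNneq _ xA)) ?mulr0 // => ->; apply: enum_valP.
- move=> y yB; have /matrixP/(_ 0 (enum_rank_in yB y)) := vN.
  rewrite mxE [RHS]mxE => vy; rewrite -[RHS]vy.
  transitivity (\sum_x \sum_b v 0 b * (x == enum_val b)%:R * K x y).
    by apply: eq_bigr => x _; rewrite mulr_suml.
  rewrite exchange_big; apply: eq_bigr => b _ /=.
  rewrite mxE enum_rankK_in // (bigD1 (enum_val b)) //= eqxx mulr1 big1 ?addr0 //.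
  by move=> x /negbTE ->; rewrite mulr0 mul0r.
Qed.

Section SignedAdjacency.
Variables (n : nat) (M : {set 'I_n}).
Implicit Types (x y : input n) (u : input n -> Cplx).

(** Huang's signing. Flipping bit [j] changes it exactly when [j < i], so signed flips in distinct
    directions anticommute. *)
Definition edge_sign (i : 'I_n) x : Cplx := \prod_(k < n | (k < i)%N) (-1) ^+ x k.

Lemma edge_sign_flip i j x :
  edge_sign i (flip x [set j]) = (-1) ^+ (j < i)%N * edge_sign i x.
Proof.
rewrite /edge_sign; under eq_bigr do rewrite ffunE signr_addb.
rewrite big_split /= mulrC; congr (_ * _).
have [ji|ij] := ltnP j i.
  rewrite (bigD1 j) //= set11 big1 ?mulr1 // => k /andP[_ /negbTE kj].
  by rewrite inE kj.
apply: big1 => k ki; rewrite inE.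
suff -> : (k == j) = false by [].
by apply: contraTF ki => /eqP ->; rewrite -leqNgt.
Qed.

Lemma edge_signK i x : edge_sign i x * edge_sign i x = 1.
Proof. by rewrite -big_split big1 //= => k _; rewrite -expr2 sqrr_sign. Qed.

Definition signed_adj u x : Cplx := \sum_(i in M) edge_sign i x * u (flip x [set i]).

(** Walks flipping the same bit twice return to [x] with sign 1, one per element of [M]. Walks
    [i, j] and [j, i] end at the same input with opposite signs and cancel. *)
Lemma signed_adj_sq u x : signed_adj (signed_adj u) x = #|M|%:R * u x.
Proof.
pose G i j := edge_sign i x * (edge_sign j (flip x [set i]) *
   u (flip (flip x [set i]) [set j])).
have -> : signed_adj (signed_adj u) x = \sum_(i in M) \sum_(j in M) G i j.
  by apply: eq_bigr => i _; rewrite mulr_sumr.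
pose H i j := if i == j then 0 else G i j.
have Gii i : G i i = u x.
  by rewrite /G flipK edge_sign_flip ltnn expr0 mul1r mulrA edge_signK mul1r.
have HN i j : H i j = - H j i.
  rewrite /H eq_sym; case: eqVneq => [_|ji]; first by rewrite oppr0.
  rewrite /G !edge_sign_flip (flipAC x [set i]).
  have : ((i < j)%N : nat) = ~~ (j < i)%N by move: ji; rewrite -val_eqE /=; lia.
  by case: (j < i)%N => /= ->; ring.
have H0 : \sum_(i in M) \sum_(j in M) H i j = 0.
  set S := \sum_(i in M) _; have : S = - S.
    rewrite {1}/S exchange_big -sumrN; apply: eq_bigr => i _.
    by rewrite -sumrN; apply: eq_bigr => j _; apply: HN.
  by move/eqP; rewrite -addr_eq0 -mulr2n mulrn_eq0 => /eqP.
rewrite -[RHS]addr0 -[X in _ + X]H0 mulr_natl -sumr_const -big_split.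
apply: eq_bigr => i iM /=; rewrite (bigD1 i) //= Gii [in RHS](bigD1 i) //=.
rewrite {1}/H eqxx add0r; congr (_ + _); apply: eq_bigr => j /andP[_ ji].
by rewrite /H eq_sym (negbTE ji).
Qed.

(* The image of [signed_adj + sqrtC #|M|] is an eigenspace, and restricting its
   argument to half of the cube makes the map injective. *)
Lemma signed_adj_eigenvector i0 x (Z : {set input n}) :
  i0 \in M -> (#|Z| < #|cube (M :\ i0) x|)%N ->
  exists u, [/\ exists y, u y != 0, forall y, y \notin cube M x -> u y = 0,
    forall y, y \in Z -> u y = 0
    & forall y, signed_adj u y = sqrtC #|M|%:R * u y].
Proof.
move=> i0M ltZ; set r := sqrtC _.
(* [K z y] is the coefficient of [w z] in [signed_adj w y + r * w y]. *)
pose K z y : Cplx :=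
  \sum_(i in M) edge_sign i y * (z == flip y [set i])%:R + r * (z == y)%:R.
have [w [[x1 wx1] wQ wZ]] := exists_vanishing K ltZ.
pose u y := signed_adj w y + r * w y.
have uE y : \sum_z w z * K z y = u y.
  under eq_bigr do rewrite mulrDr; rewrite big_split /=; congr (_ + _).
    under eq_bigr do rewrite mulr_sumr.
    rewrite exchange_big; apply: eq_bigr => i _ /=.
    rewrite (bigD1 (flip y [set i])) //= eqxx mulr1 mulrC big1 ?addr0 //.
    by move=> z /negbTE ->; rewrite !mulr0.
  rewrite (bigD1 y) //= eqxx mulr1 mulrC big1 ?addr0 //.
  by move=> z /negbTE ->; rewrite !mulr0.
have wM y : y \notin cube M x -> w y = 0.
  by move=> yM; apply: wQ; apply: contra yM; apply/subsetP/cubeS/subD1set.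
exists u; split.
- have x1Q : x1 \in cube (M :\ i0) x by apply: contraNT wx1 => /wQ ->.
  (* This input lies off the face supporting [w], and among its neighbours along [M] only [x1] lies
     on it, so [u] equals [w x1] up to sign. *)
  exists (flip x1 [set i0]).
  have out y : (y \in cube (M :\ i0) x) -> y i0 = x i0.
    by move=> /cubeP; apply; rewrite !inE eqxx.
  have w0 (B : {set 'I_n}) : i0 \in B -> w (flip x1 B) = 0.
    move=> iB; apply: wQ; apply: contraTN isT => /out.
    by rewrite ffunE iB -(out _ x1Q); case: (x1 i0).
  rewrite /u w0 ?set11 // mulr0 addr0 /signed_adj (bigD1 i0) //= flipK big1 ?addr0.
    rewrite mulf_neq0 //; apply: contraNneq (oner_neq0 Cplx) => e0.
    by rewrite -(edge_signK i0 (flip x1 [set i0])) e0 mul0r.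
  move=> i /andP[_ ii0]; rewrite [w _](_ : _ = 0) ?mulr0 //.
  rewrite (_ : flip _ _ = flip x1 [set i0; i]) ?w0 ?set21 //.
  apply/ffunP => j; rewrite !ffunE !inE -addbA; congr (_ (+) _).
  by case: (eqVneq j i0) => // ->; rewrite eq_sym (negbTE ii0).
- move=> y yM; rewrite /u wM // mulr0 addr0; apply: big1 => i iM.
  by rewrite wM ?mulr0 // flip_in_cube.
- by move=> y /wZ; rewrite uE.
- move=> y; rewrite /u.
  have -> : signed_adj (fun y => signed_adj w y + r * w y) y =
            signed_adj (signed_adj w) y + r * signed_adj w y.
    rewrite [in X in _ + _ * X]/signed_adj mulr_sumr -big_split.
    by apply: eq_bigr => i _ /=; ring.
  by rewrite signed_adj_sq -[#|M|%:R]sqrtCK -/r; ring.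
Qed.

End SignedAdjacency.

(** * Subcubes on which [f] has full degree *)

Lemma card_set1I (I : finType) (x : I) (A : {set I}) : #|[set x] :&: A| = (x \in A).
Proof.
have [xA|xA] := boolP (x \in A); first by rewrite (setIidPl _) ?sub1set ?cards1.
by apply/eqP; rewrite cards_eq0 setI_eq0 disjoints1.
Qed.

Section Unbalanced.
Variables (n : nat) (f : input n -> bool).
Implicit Types (x y z : input n) (M V : {set 'I_n}).

(** The sign classes of [f] times parity. On [cube M x] the bits outside [M] are constant, so taking
    the parity of all [n] bits at most swaps the classes. *)
Definition twist b : {set input n} :=
  [set y | f y (+) \big[addb/false]_i y i == b].

(* [M] is unbalanced at [x] iff the restriction of [f] to [cube M x], as a
   multilinear polynomial in the variables of [M], has full degree [#|M|]. *)
Definition unbalanced M x : bool :=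
  #|cube M x :&: twist true| != #|cube M x :&: twist false|.

(** A flip always changes the parity, so an edge stays inside a class exactly when it is
    sensitive. *)
Lemma twist_flip y i b :
  (flip y [set i] \in twist b) = ((y \in twist b) (+) (f (flip y [set i]) == f y)).
Proof.
rewrite !inE.
under eq_bigr do rewrite ffunE.
rewrite big_split /= [\big[_/_]_i (i \in _)](_ : _ = true).
  by case: (f y) (f _) b (\big[_/_]_i _) => [] [] [] [].
by rewrite (bigD1 i) //= set11 big1 // => j /negbTE ji; rewrite inE ji.
Qed.

Lemma twistC b : twist (~~ b) = ~: twist b.
Proof. by apply/setP => y; rewrite !inE; case: (_ (+) _) b => [] []. Qed.

Lemma unbalanced_cube M x y : y \in cube M x -> unbalanced M y = unbalanced M x.
Proof. by rewrite /unbalanced => /cube_eq ->. Qed.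

Lemma unbalanced0 x : unbalanced set0 x.
Proof.
rewrite /unbalanced cube0 !card_set1I -[false]/(~~ true) twistC in_setC.
by case: (x \in _).
Qed.

(** When the union of two opposite faces is balanced, their class differences are opposite
    numbers. *)
Lemma unbalanced_flip M x i : i \notin M -> ~~ unbalanced (i |: M) x ->
  unbalanced M (flip x [set i]) = unbalanced M x.
Proof.
by move=> iM; rewrite /unbalanced !(card_cubeU1 _ _ iM) negbK => /eqP h; apply/idP/idP; lia.
Qed.

(** If [f] were constant on the subcube, flipping a bit of [M] would swap the two classes and
    balance them. *)
Lemma unbalanced_sensitive M x : M != set0 -> unbalanced M x ->
  exists2 B : {set 'I_n}, B \subset M & f (flip x B) != f x.
Proof.
case/set0Pn => i iM unb.
have [/exists_inP[B BM fB]|] := boolP [exists (B : {set 'I_n} | B \subset M), f (flip x B) != f x].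
  by exists B.
rewrite negb_exists_in => /forall_inP fE.
have {}fE y : y \in cube M x -> f y = f x.
  by case/cube_flipP => B BM ->; apply/eqP; rewrite -[_ == _]negbK; apply: fE.
have le b : (#|cube M x :&: twist b| <= #|cube M x :&: twist (~~ b)|)%N.
  rewrite -(card_imset _ (inv_inj (@flipK n [set i]))); apply: subset_leq_card.
  apply/subsetP => _ /imsetP[y /setIP[yM yb] ->].
  have fyM : flip y [set i] \in cube M x by rewrite flip_in_cube.
  by rewrite inE fyM twistC inE twist_flip yb !fE // eqxx.
by case/negP: unb; rewrite eqn_leq (le true) (le false).
Qed.

(** Take [M] maximal among the sets unbalanced somewhere in the cube. Adding a variable gives
    balance everywhere, so unbalance spreads across all flips. If [M] is empty, balance of every
    single variable makes [f] constant. *)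
Lemma maximal_unbalanced V y :
  (forall x, x \in cube V y -> f x = f y) \/
  exists M, [/\ M \subset V, M != set0 & forall x, x \in cube V y -> unbalanced M x].
Proof.
pose P M := (M \subset V) && [exists x in cube V y, unbalanced M x].
have P0 : P set0.
  rewrite /P sub0set; apply/exists_inP.
  by exists y; [exact: cube_refl|exact: unbalanced0].
have [M /maxsetP[/andP[MV /exists_inP[x0 x0V ux0]] maxM] _] := maxset_exists P0.
have bal i z : i \in V -> i \notin M -> z \in cube V y -> ~~ unbalanced (i |: M) z.
  move=> iV iM zV; apply/negP => uz; case/negP: iM.
  rewrite -(maxM (i |: M)) ?setU11 ?subsetU1 //.
  by rewrite /P subUset sub1set iV MV; apply/exists_inP; exists z.
have unb x : x \in cube V y -> unbalanced M x.
  rewrite -(cube_eq x0V); apply: (@cube_ind _ V x0 (unbalanced M)) => // z i.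
  rewrite (cube_eq x0V) => zV iV; have [iM|iM] := boolP (i \in M).
    by rewrite (@unbalanced_cube _ z) // flip_cube ?sub1set.
  by rewrite unbalanced_flip // bal.
have [M0|M0] := eqVneq M set0; [left|by right; exists M].
apply: (@cube_ind _ V y (fun x => f x = f y)) => // z i zV iV <-.
have := bal i z iV; rewrite M0 inE => /(_ isT zV).
rewrite /unbalanced !card_cubeU1 ?inE // !cube0 !card_set1I !twist_flip.
rewrite -[false]/(~~ true) twistC in_setC.
by case: (eqVneq (f (flip z [set i])) (f z)) => // _; case: (z \in _).
Qed.

Lemma huang_bound T M x : qcomputes f T -> unbalanced M x -> (#|M| <= (36 * T) ^ 2)%N.
Proof.
move=> qf unb.
have [->|[i0 i0M]] := set_0Vmem M; first by rewrite cards0.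
have cM : #|cube M x| = (2 * #|cube (M :\ i0) x|)%N.
  have := @card_cubeU1 n setT (M :\ i0) i0 x; rewrite !setIT setD1K // setD11 => ->//.
  by rewrite card_cube_flip addnn mul2n.
have [b ltb] : exists b, (#|cube M x :&: twist (~~ b)| < #|cube M x :&: twist b|)%N.
  by move: unb; rewrite /unbalanced neq_ltn => /orP[]; [exists false|exists true].
(* The smaller class has less than half of the cube, leaving room for an eigenvector that vanishes
   on it. *)
set Z := cube M x :&: twist (~~ b) in ltb.
have ltZ : (#|Z| < #|cube (M :\ i0) x|)%N.
  have := cardsID (twist b) (cube M x); rewrite cM setDE -twistC -/Z; lia.
have [u [[y0 uy0] uM uZ Au]] := signed_adj_eigenvector i0M ltZ.
pose v y := `|u y|.
have v_ge0 y : 0 <= v y by apply: normr_ge0.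
have disj (i j j' : 'I_n) : j \in M -> j' \in M -> i \in [set j] -> i \in [set j'] -> j = j'.
  by move=> _ _ /set1P <- /set1P.
(* An insensitive edge joins the two classes, so one of its ends lies in [Z]. *)
have uflip y i : i \in M -> f (flip y [set i]) = f y -> u y = 0 \/ u (flip y [set i]) = 0.
  move=> iM fE; have [yM|/uM ->] := boolP (y \in cube M x); last by left.
  have [yb|yb] := boolP (y \in twist b).
    right; apply: uZ; rewrite inE flip_in_cube // yM twistC in_setC twist_flip yb fE.
    by rewrite eqxx.
  by left; apply: uZ; rewrite inE yM twistC in_setC.
have S_gt0 : 0 < \sum_y v y ^+ 2.
  rewrite (bigD1 y0) //= ltr_pwDl ?exprn_gt0 ?normr_gt0 //.
  by apply: sumr_ge0 => y _; rewrite exprn_ge0.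
apply: sqrtC_le_nat; rewrite -(ler_pM2r S_gt0).
apply: le_trans (adversary disj v_ge0 qf).
rewrite mulr_sumr; apply: ler_sum => y _.
have -> : sqrtC #|M|%:R * v y ^+ 2 = v y * `|signed_adj M u y|.
  by rewrite Au normrM ger0_norm ?sqrtC_ge0 ?ler0n // expr2 mulrCA.
apply: le_trans (ler_wpM2l _ (ler_norm_sum _ _ _)) _ => //.
rewrite mulr_sumr [leRHS]big_mkcondr /=; apply: ler_sum => i iM.
rewrite normrM [`|edge_sign _ _|](_ : _ = 1) ?mul1r; last first.
  by apply/eqP; rewrite -sqrp_eq1 // -normrX expr2 edge_signK normr1.
case: eqP => [fE|_] //=.
by case: (uflip y i iM fE) => u0; rewrite /v u0 normr0 ?mul0r ?mulr0.
Qed.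

End Unbalanced.

(** * Midrijanis' decision tree *)

Section DecisionTree.
Variables (n : nat) (f : input n -> bool).
Implicit Types (x y : input n) (M V : {set 'I_n}).

Definition tree_on V y h : Prop :=
  exists t : dtree n, (forall x, x \in cube V y -> deval t x = f x) /\ (depth t <= h)%N.

Lemma tree_on_query M V y h : M \subset V ->
  (forall y', y' \in cube V y -> tree_on (V :\: M) y' h) -> tree_on V y (#|M| + h).
Proof.
have [m] := ubnP #|M|; elim: m M V y => // m IH M V y ltm MV hM.
have [M0|[i iM]] := set_0Vmem M.
  by rewrite M0 cards0; have := hM y (cube_refl _ _); rewrite M0 setD0.
pose set_bit b : input n := [ffun j => if j == i then b else y j].
have iV := subsetP MV i iM.
have yb b : set_bit b \in cube V y.
  by apply/cubeP => j jV; rewrite ffunE; case: eqP jV => // ->; rewrite iV.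
have sub b : tree_on (V :\ i) (set_bit b) (#|M :\ i| + h).
  apply: IH; first by move: ltm; rewrite (cardsD1 i) iM.
    exact: setSD.
  move=> y' y'V; have -> : V :\ i :\: (M :\ i) = V :\: M.
    apply/setP => j; rewrite !inE; case: eqP => [->|] //=.
    by rewrite iM.
  apply: hM; apply: cube_trans (yb b) _.
  by apply: subsetP y'V; apply/cubeS/subD1set.
have [t0 [e0 d0]] := sub false; have [t1 [e1 d1]] := sub true.
exists (DNode i t0 t1); split=> [x xV /=|]; last first.
  by rewrite (cardsD1 i) iM /= add1n addSn ltnS geq_max d0 d1.
have xb : x \in cube (V :\ i) (set_bit (x i)).
  apply/cubeP => j; rewrite !inE negb_and negbK ffunE.
  by case: eqP => [->|_] //= jV; apply: (cubeP _ _ _ xV).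
by case: ifP xb => _; [apply: e1|apply: e0].
Qed.

Lemma tree_on_leq V y h h' : (h <= h')%N -> tree_on V y h -> tree_on V y h'.
Proof. by move=> hh [t [e d]]; exists t; split=> //; apply: leq_trans hh. Qed.

Definition sensitive_blocks x (F : {set {set 'I_n}}) : Prop :=
  trivIset F /\ forall B, B \in F -> f (flip x B) != f x.

Variables (d k : nat).
Hypothesis unbalanced_le : forall M x, unbalanced f M x -> (#|M| <= d)%N.
Hypothesis blocks_le : forall x F, sensitive_blocks x F -> (#|F| <= k)%N.

(** [V] holds the variables still unqueried, so the blocks lie among the queried ones; [j] measures
    the progress at [x]. *)
Definition has_blocks_off V x j : Prop := exists F, [/\ sensitive_blocks x F,
  forall B : {set 'I_n}, B \in F -> [disjoint B & V] & (j <= #|F|)%N].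

(** The new block comes from inside [M], hence from [V], and is disjoint from all earlier ones. *)
Lemma has_blocks_off_query V M x j : M \subset V -> M != set0 -> unbalanced f M x ->
  has_blocks_off V x j -> has_blocks_off (V :\: M) x j.+1.
Proof.
move=> MV M0 /(unbalanced_sensitive M0)[B BM fB] [F [[tF sF] dF jF]].
have dB A : A \in F -> [disjoint A & B].
  by move=> /dF; apply: disjointWr; apply: subset_trans MV.
(* A nonempty block disjoint from all members of [F] is not a member itself, so the family really
   grows. *)
have B0 : B != set0 by apply: contraNneq fB => ->; rewrite flip0.
have BF : B \notin F.
  by apply: contra B0 => /dB; rewrite -setI_eq0 setIid.
exists (B |: F); split; last by rewrite cardsU1 BF.
  split=> [|A /setU1P[->|/sF] //].
  apply/trivIsetP => A A' /setU1P[->|AF] /setU1P[->|A'F] neqA.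
  - by rewrite eqxx in neqA.
  - by rewrite disjoint_sym dB.
  - exact: dB.
  - by apply: (trivIsetP tF).
move=> A /setU1P[->|/dF]; last by apply: disjointWr; apply: subsetDl.
by rewrite disjoint_sym (disjointWr BM) // disjoints_subset setDE subsetIr.
Qed.

(** [h] is the number of rounds left. At [h = 0] another unbalanced set would give more than [k]
    blocks, so [f] is already constant. *)
Lemma tree_on_rounds h V y :
  (forall x, x \in cube V y -> has_blocks_off V x (k - h)) -> tree_on V y (h * d).
Proof.
elim: h V y => [|h IH] V y hV;
  have [fc|[M [MV M0 unb]]] := maximal_unbalanced f V y;
  try by exists (DLeaf n (f y)); split=> // x /fc ->.
  have yV := cube_refl V y.
  have [F [sF _]] := has_blocks_off_query MV M0 (unb y yV) (hV y yV).
  by rewrite subn0 ltnNge (blocks_le sF).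
apply: (@tree_on_leq _ _ (#|M| + h * d)).
  by rewrite mulSn leq_add2r (unbalanced_le (unb y (cube_refl V y))).
apply: tree_on_query => // y' y'V; apply: IH => x xV.
have {}xV : x \in cube V y.
  by apply: cube_trans y'V _; apply: subsetP xV; apply/cubeS/subsetDl.
have [F [sF dF jF]] := has_blocks_off_query MV M0 (unb x xV) (hV x xV).
(* [k - h <= (k - h.+1).+1] holds for truncated subtraction too. *)
by exists F; split=> //; apply: leq_trans jF; lia.
Qed.

Lemma decision_tree : dcomputes f (k * d).
Proof.
have [t [e dt]] : tree_on setT [ffun=> false] (k * d).
  apply: tree_on_rounds => x _; exists set0; split; last by rewrite subnn.
    split; last by move=> B; rewrite inE.
    by apply/trivIsetP => B; rewrite inE.
  by move=> B; rewrite inE.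
by exists t; split=> // x; apply: e; apply/cubeP => i; rewrite inE.
Qed.
End DecisionTree.

(* D(f) <= C * Q(f)^4: whenever f has a T-query bounded-error quantum
   algorithm, f has a deterministic decision tree of depth <= C * T^4. *)
Theorem theorem1p2 :
  exists C : nat, forall (n : nat) (f : input n -> bool) (T : nat),
    qcomputes f T -> dcomputes f (C * T ^ 4)%N.
Proof.
exists (72 ^ 2 * 36 ^ 2)%N => n f T qf.
have -> : (72 ^ 2 * 36 ^ 2 * T ^ 4 = (72 * T) ^ 2 * (36 * T) ^ 2)%N.
  by rewrite !expnMn mulnACA -expnD.
apply: decision_tree => [M x|x F [tF sF]]; first exact: huang_bound.
exact: block_sensitivity sF.
Qed.
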